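(* Let $m$ be a polyhedral surface and $s$ a mesh parallel to $m$ (its Gauss image). The pair $(m,s)$ is minimal if and only if $m$ is a discrete Koenigs net and $s$ is its Christoffel dual, $s=m^*$.
   Context: Mesh combinatorics: a 2-dimensional cell complex $(V,E,F)$. A mesh is a map $m:V\to\mathbb{R}^3$, $i\mapsto m_i$; for a face $f=(i_1,\dots,i_n)$, $m(f)=(m_{i_1},\dots,m_{i_n})$. A mesh is a polyhedral surface if the vertices of each face are mapped to coplanar points. Meshes $m,s$ are parallel if for each edge $(i,j)\in E$ the vectors $m_i-m_j$, $s_i-s_j$ are linearly dependent. $m$ is assumed to have no zero edges, and corresponding faces $m(f)$, $s(f)$ lie in planes parallel to a common 2-dimensional subspace $U_f$. Oriented area in $U_f$ (up to translation): $A(P)=\frac12\sum_i\det(p_i,p_{i+1})$ (indices mod $n$) for $P=(p_0,\dots,p_{n-1})$; $A(P,Q)$ is the associated symmetric bilinear form (mixed area). The faces of $m$ are assumed to have $A(m(f))\neq0$, and the mean curvature of face $f$ of the pair $(m,s)$ is $H_f=-A(m(f),s(f))/A(m(f))$. The pair $(m,s)$ is called minimal if $H_f=0$ for all faces $f$. Polyhedral surfaces $m,s$ are Christoffel dual, $s=m^*$ (meaning: $s$ is a Christoffel dual of $m$), if they are parallel and corresponding faces have vanishing mixed area, $A(m(f),s(f))=0$ for all $f$. A (discrete) Koenigs net is a polyhedral surface possessing a Christoffel dual. *)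

(* Defs.v *)
From HB Require Import structures.
From mathcomp Require Import all_boot all_order all_algebra.
From mathcomp Require Import reals.

Set Implicit Arguments.
Unset Strict Implicit.
Unset Printing Implicit Defensive.

Import Order.TTheory GRing.Theory Num.Theory.
Local Open Scope ring_scope.

(* A polygonal 2-dimensional cell complex (V, E, F): the face [f] is glued
   along the closed edge path [boundary f] of length [fsize f]; [ordS] is the
   cyclic successor, i.e. indices along a face are taken mod [fsize f].
   Finiteness is not required, and a boundary path may revisit a vertex. *)
Record cell_complex := CellComplex {
  vertex : Type;
  edge : vertex -> vertex -> Prop;
  face : Type;
  fsize : face -> nat;
  boundary : forall f : face, 'I_(fsize f) -> vertex;
  edge_sym : forall i j, edge i j -> edge j i;
  fsize_ge3 : forall f, (3 <= fsize f)%N;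
  boundary_edge : forall (f : face) (k : 'I_(fsize f)),
    edge (boundary k) (boundary (ordS k))
}.

Arguments boundary {c} f _.

Definition mesh (R : realType) (K : cell_complex) := vertex K -> 'rV[R]_3.

(* Polygons with n vertices in R^3 are n x 3 matrices, one vertex per row. *)
Definition mesh_face (R : realType) (K : cell_complex) (m : mesh R K)
    (f : face K) : 'M[R]_(fsize f, 3) :=
  \matrix_(k < fsize f) m (boundary f k).

(* The polygon P lies in an affine plane a + U, U being the row space. *)
Definition in_parallel_plane (R : realType) (k n : nat) (U : 'M[R]_(k, 3))
    (P : 'M[R]_(n, 3)) : Prop :=
  exists a : 'rV[R]_3, forall i : 'I_n, (row i P - a <= U)%MS.

Definition coplanar (R : realType) (n : nat) (P : 'M[R]_(n, 3)) : Prop :=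
  exists U : 'M[R]_3, \rank U = 2%N /\ in_parallel_plane U P.

Definition polyhedral_surface (R : realType) (K : cell_complex)
    (m : mesh R K) : Prop :=
  forall f : face K, coplanar (mesh_face m f).

Definition parallel_meshes (R : realType) (K : cell_complex)
    (m s : mesh R K) : Prop :=
  forall i j : vertex K, edge i j -> ~~ free [:: m i - m j; s i - s j].

Definition no_zero_edges (R : realType) (K : cell_complex)
    (m : mesh R K) : Prop :=
  forall i j : vertex K, edge i j -> m i != m j.

(* An oriented 2-dimensional subspace U of R^3 is given by an orthonormal
   basis, the two rows of a matrix B.  The oriented area does not depend on
   the basis beyond the orientation of U. *)
Definition orthonormal_frame (R : realType) (B : 'M[R]_(2, 3)) : Prop :=
  B *m B^T = 1%:M.

(* The rows of [P *m B^T] are the coordinates in U of the vertices of P,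
   after translating the plane of P onto U along the normal of U. *)
Definition oriented_area (R : realType) (B : 'M[R]_(2, 3)) (n : nat)
    (P : 'M[R]_(n, 3)) : R :=
  let p i : 'rV[R]_2 := row i (P *m B^T) in
  2^-1 * \sum_(i < n) \det (col_mx (p i) (p (ordS i)) : 'M[R]_2).

(* Polarization: [mixed_area B P P = oriented_area B P]. *)
Definition mixed_area (R : realType) (B : 'M[R]_(2, 3)) (n : nat)
    (P Q : 'M[R]_(n, 3)) : R :=
  2^-1 * (oriented_area B (P + Q) - oriented_area B P - oriented_area B Q).

Definition mean_curvature (R : realType) (K : cell_complex)
    (B : face K -> 'M[R]_(2, 3)) (m s : mesh R K) (f : face K) : R :=
  - mixed_area (B f) (mesh_face m f) (mesh_face s f)
    / oriented_area (B f) (mesh_face m f).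

Definition minimal_pair (R : realType) (K : cell_complex)
    (B : face K -> 'M[R]_(2, 3)) (m s : mesh R K) : Prop :=
  forall f : face K, mean_curvature B m s f = 0.

(* The notion is intrinsic to (m, s): whether the mixed area of two polygons
   in parallel planes vanishes does not depend on the frame B. *)
Definition christoffel_dual (R : realType) (K : cell_complex)
    (m s : mesh R K) : Prop :=
  [/\ polyhedral_surface m, polyhedral_surface s, parallel_meshes m s &
      forall f : face K, exists B : 'M[R]_(2, 3),
        [/\ orthonormal_frame B,
            in_parallel_plane B (mesh_face m f),
            in_parallel_plane B (mesh_face s f) &
            mixed_area B (mesh_face m f) (mesh_face s f) = 0]].

Definition koenigs_net (R : realType) (K : cell_complex)
    (m : mesh R K) : Prop :=
  polyhedral_surface m /\ exists s : mesh R K, christoffel_dual m s.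

(* Main.v *)
Require Import Defs.
From HB Require Import structures.
From mathcomp Require Import all_boot all_order all_algebra.
From mathcomp Require Import reals ring.

Import Order.TTheory GRing.Theory Num.Theory.
Local Open Scope ring_scope.

(** Since the area of [m(f)] is nonzero, [H_f = 0] says that the mixed area of [m(f)] and
    [s(f)], measured in the given frame [B f], vanishes; this is the
    Christoffel condition measured in one particular frame.  So the pair being
    minimal makes [s] a Christoffel dual at once, [B f] being the witness, and the given
    planes of [s(f)] making [s] polyhedral.

    Conversely a Christoffel dual comes with some other frame [B'] for each
    face, and the content of the theorem is that the choice of frame is
    immaterial.  The face [m(f)] has nonzero area, so the differences of its
    vertices already span a plane ([rank_vertex_differences]); they lie in the
    row spaces of both frames, hence these row spaces coincide
    ([parallel_plane_unique]).  Then [B f = C *m B'] for a 2 x 2 matrix [C], and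
    mixed areas in the two frames differ by the factor [\det C]
    ([mixed_area_change_frame]). *)

Lemma det_col_mx_row2 (R : comNzRingType) (u v : 'rV[R]_2) :
  \det (col_mx u v : 'M[R]_2) = u 0 0 * v 0 1 - u 0 1 * v 0 0.
Proof.
rewrite (expand_det_row _ 0) !big_ord_recl big_ord0 /cofactor !det_mx11 !mxE /=.
have -> : lift 0 0 = 1 :> 'I_2 by apply: val_inj.
have -> : lift 1 0 = 0 :> 'I_2 by apply: val_inj.
have -> : split (0 : 'I_(1 + 1)) = inl 0.
  by case: splitP => j //; rewrite (ord1 j).
have -> : split (1 : 'I_(1 + 1)) = inr 0.
  by case: splitP => j //; rewrite (ord1 j).
rewrite !mul1r expr1; ring.
Qed.

(** Each term changes by [det (p_(i+1), a) - det (p_i, a)], and these cancel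
    around the closed polygon. *)
Lemma oriented_area_translate {R : realType} {n : nat} (B : 'M[R]_(2, 3))
    (P : 'M[R]_(n, 3)) (a : 'rV[R]_3) :
  oriented_area B (P - const_mx 1 *m a) = oriented_area B P.
Proof.
rewrite /oriented_area; congr (_ * _).
pose t := a *m B^T.
pose g (i : 'I_n) := (P *m B^T) i 0 * t 0 1 - (P *m B^T) i 1 * t 0 0.
have entry (i : 'I_n) k :
    ((P - const_mx 1 *m a) *m B^T) i k = (P *m B^T) i k - t 0 k.
  rewrite mulmxBl -mulmxA -/t [LHS]mxE [X in _ + X]mxE; congr (_ - _).
  by rewrite mxE big_ord1 mxE mul1r.
have sum_g : \sum_i g (ordS i) = \sum_i g i.
  by rewrite [RHS](reindex_inj (can_inj (@ordSK n))).
apply/eqP; rewrite -subr_eq0 -sumrB; apply/eqP.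
transitivity (\sum_i (g (ordS i) - g i)); last by rewrite sumrB sum_g subrr.
apply: eq_bigr => i _; rewrite !det_col_mx_row2 ![row _ _ _ _]mxE !entry /g.
ring.
Qed.

(** If [D] had rank at most 1, then any two of its rows would be proportional
    and every determinant in the area would vanish. *)
Lemma rank_of_oriented_area {R : realType} {n : nat} (B : 'M[R]_(2, 3))
    (D : 'M[R]_(n, 3)) :
  oriented_area B D != 0 -> (2 <= \rank D)%N.
Proof.
apply: contraNT; rewrite -ltnNge ltnS => rankD.
rewrite /oriented_area big1 ?mulr0 // => i _.
apply/eqP; apply: contraTT rankD => det_neq0; rewrite -ltnNge.
set M := col_mx _ _ in det_neq0.
have rankM : \rank (M : 'M[R]_2) = 2%N.
  by apply: mxrank_unit; rewrite unitmxE unitfE.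
apply: (@leq_trans (\rank M)); first by rewrite rankM.
rewrite /M !row_mul -mul_col_mx; apply: leq_trans (mxrankM_maxl _ _) (mxrankS _).
by rewrite col_mx_sub !row_sub.
Qed.

(** Translation invariance turns the bound for lines through the origin into
    one for all lines. *)
Lemma rank_vertex_differences {R : realType} {n : nat} (B : 'M[R]_(2, 3))
    (P : 'M[R]_(n, 3)) (a : 'rV[R]_3) :
  oriented_area B P != 0 -> (2 <= \rank (P - const_mx 1 *m a)%R)%N.
Proof.
by rewrite -(oriented_area_translate B P a) => /rank_of_oriented_area.
Qed.

Lemma vertex_differences_sub {R : realType} {n k : nat} (U : 'M[R]_(k, 3))
    (P : 'M[R]_(n, 3)) (i0 : 'I_n) :
  in_parallel_plane U P -> (P - const_mx 1 *m row i0 P <= U)%MS.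
Proof.
case=> a Pa; apply/row_subP => i.
rewrite linearB /= row_mul row_const.
have -> : (const_mx 1 : 'M[R]_1) = 1%:M.
  by apply/matrixP=> x y; rewrite !ord1 !mxE.
rewrite mul1mx.
have -> : row i P - row i0 P = (row i P - a) - (row i0 P - a).
  by rewrite opprB addrA subrK.
by rewrite addmx_sub ?eqmx_opp.
Qed.

(** Both row spaces have dimension at most 2 and contain the 2-dimensional
    span of the differences of the vertices. *)
Lemma parallel_plane_unique {R : realType} {n : nat} (A B B' : 'M[R]_(2, 3))
    (P : 'M[R]_(n, 3)) (i0 : 'I_n) :
  oriented_area A P != 0 -> in_parallel_plane B P -> in_parallel_plane B' P ->
  (B' <= B)%MS.
Proof.
move=> area /(vertex_differences_sub _ _ i0) DB.
move=> /(vertex_differences_sub _ _ i0) DB'.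
have rankD := rank_vertex_differences A P (row i0 P) area.
apply: submx_trans DB.
rewrite -(mxrank_leqif_sup DB') eqn_leq mxrankS //=.
exact: leq_trans (rank_leq_row B') rankD.
Qed.

Lemma oriented_area_mull {R : realType} {n : nat} (C : 'M[R]_2)
    (B : 'M[R]_(2, 3)) (P : 'M[R]_(n, 3)) :
  oriented_area (C *m B) P = \det C * oriented_area B P.
Proof.
rewrite /oriented_area mulrCA; congr (_ * _); rewrite mulr_sumr.
apply: eq_bigr => i _; rewrite trmx_mul mulmxA !(row_mul _ _ C^T) -mul_col_mx.
by rewrite det_mulmx det_tr mulrC.
Qed.

Lemma mixed_area_mull {R : realType} {n : nat} (C : 'M[R]_2)
    (B : 'M[R]_(2, 3)) (P Q : 'M[R]_(n, 3)) :
  mixed_area (C *m B) P Q = \det C * mixed_area B P Q.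
Proof. rewrite /mixed_area !oriented_area_mull; ring. Qed.

(** The two frames span the same plane, so [B = C *m B'], and passing from [B']
    to [B] multiplies the mixed area by [\det C]. *)
Lemma mixed_area_change_frame {R : realType} {n : nat} (B B' : 'M[R]_(2, 3))
    (P Q : 'M[R]_(n, 3)) (i0 : 'I_n) :
  oriented_area B P != 0 -> in_parallel_plane B P -> in_parallel_plane B' P ->
  mixed_area B' P Q = 0 -> mixed_area B P Q = 0.
Proof.
move=> area PB PB' mixed0.
have /submxP[C ->] := parallel_plane_unique _ _ _ _ i0 area PB' PB.
by rewrite mixed_area_mull mixed0 mulr0.
Qed.

Lemma coplanar_in_frame {R : realType} {n : nat} (B : 'M[R]_(2, 3))
    (P : 'M[R]_(n, 3)) :
  orthonormal_frame B -> in_parallel_plane B P -> coplanar P.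
Proof.
move=> orthoB [a Pa]; exists <<B>>%MS; split; last first.
  by exists a => i; rewrite genmxE.
rewrite genmxE; apply/eqP; rewrite eqn_leq rank_leq_row /=.
by rewrite -{1}(mxrank1 R 2) -orthoB mxrankM_maxl.
Qed.

Theorem theorem13 (R : realType) (K : cell_complex) (m s : mesh R K)
    (B : face K -> 'M[R]_(2, 3))
    (m_polyhedral : polyhedral_surface m)
    (ms_parallel : parallel_meshes m s)
    (m_edges : no_zero_edges m)
    (B_frame : forall f : face K, orthonormal_frame (B f))
    (m_planes : forall f : face K, in_parallel_plane (B f) (mesh_face m f))
    (s_planes : forall f : face K, in_parallel_plane (B f) (mesh_face s f))
    (m_area : forall f : face K, oriented_area (B f) (mesh_face m f) != 0) :
  minimal_pair B m s <-> koenigs_net m /\ christoffel_dual m s.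
Proof.
split=> [minimal | [_ [_ _ _ dual]] f].
- have dual : christoffel_dual m s.
    split=> // f; first exact: coplanar_in_frame _ _ (B_frame f) (s_planes f).
    exists (B f); split=> //; apply/eqP; move/eqP: (minimal f).
    by rewrite mulf_eq0 invr_eq0 (negPf (m_area f)) orbF oppr_eq0.
  by split=> //; split=> //; exists s.
- have [B' [_ mB' _ mixed0]] := dual f.
  pose i0 := Ordinal (leq_trans (isT : 0 < 3)%N (fsize_ge3 f)).
  have := mixed_area_change_frame _ _ _ _ i0 (m_area f) (m_planes f) mB' mixed0.
  by rewrite /mean_curvature => ->; rewrite oppr0 mul0r.
Qed.
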